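(* Let $\mu,\nu\in\mathcal{P}_{uB}$ be two unbounded-support sub-Gaussian distributions over $\mathbb{R}^h$, and let $\mathbf{x}_1,\dots,\mathbf{x}_n$ be i.i.d. from $\mu$ and $\mathbf{y}_1,\dots,\mathbf{y}_m$ be i.i.d. from $\nu$, the two collections being independent of each other. Let $L_{\mathcal{F}}>0$ and suppose $F:(\mathbb{R}^h)^{n+m}\to\mathbb{R}$ is a function of $(\mathbf{x}_1,\dots,\mathbf{x}_n,\mathbf{y}_1,\dots,\mathbf{y}_m)$ which satisfies, for every index $i$ and all values of the arguments, $$|F(\mathbf{x}_1,\dots,\mathbf{x}_i,\dots,\mathbf{y}_m)-F(\mathbf{x}_1,\dots,\mathbf{x}_i',\dots,\mathbf{y}_m)|\le L_{\mathcal{F}}\|\mathbf{x}_i-\mathbf{x}_i'\|/n,\quad 1\le i\le n,$$ $$|F(\mathbf{x}_1,\dots,\mathbf{y}_i,\dots,\mathbf{y}_m)-F(\mathbf{x}_1,\dots,\mathbf{y}_i',\dots,\mathbf{y}_m)|\le L_{\mathcal{F}}\|\mathbf{y}_i-\mathbf{y}_i'\|/m,\quad 1\le i\le m.$$ Then, for all $0\le\epsilon\le\sqrt3\,h\,\Gamma_{uB}L_{\mathcal{F}}\min\{m,n\}(n^{-1}+m^{-1})$, $$\mathbb{P}\big(F(\mathbf{x}_1,\dots,\mathbf{x}_n,\mathbf{y}_1,\dots,\mathbf{y}_m)-\mathbb{E}\,F(\mathbf{x}_1,\dots,\mathbf{x}_n,\mathbf{y}_1,\dots,\mathbf{y}_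m)\ge\epsilon\big)\le\exp\left(\frac{-\epsilon^2mn}{8h\Gamma_{uB}^2L_{\mathcal{F}}^2(m+n)}\right).$$
   Context: $\|\cdot\|$ denotes the Euclidean norm on $\mathbb{R}^h$, $h\ge1$, and $n,m\ge1$ are integers. Given $\Gamma_{uB}>0$, $\mathcal{P}_{uB}$ is the set of all Borel probability measures $\mu$ on $\mathbb{R}^h$ with unbounded support such that $\|\mathbb{E}_{\mathbf{x}\sim\mu}\mathbf{x}\|\le\Gamma_{uB}$ and, for some $\tau$ with $0<\tau\le\Gamma_{uB}$, $\mathbb{E}_{\mathbf{x}\sim\mu}e^{\mathbf{a}^T(\mathbf{x}-\mathbb{E}\mathbf{x})}\le e^{\|\mathbf{a}\|^2\tau^2/2}$ for all $\mathbf{a}\in\mathbb{R}^h$. *)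

(* Defs.v *)
From HB Require Import structures.
From mathcomp Require Import all_boot all_order all_algebra.
From mathcomp Require Import all_classical all_reals all_analysis.
Import Order.TTheory GRing.Theory Num.Theory.
Import numFieldNormedType.Exports.

Set Implicit Arguments.
Unset Strict Implicit.
Unset Printing Implicit Defensive.

Local Open Scope classical_set_scope.
Local Open Scope ring_scope.

Section euclidean.
Context {R : realType} {h : nat}.
Implicit Types u v : 'rV[R]_h.

Definition dotv u v : R := \sum_(i < h) u ord0 i * v ord0 i.

(* The library norm `|v| on 'rV[R]_h is the sup norm. *)
Definition enorm v : R := Num.sqrt (dotv v v).

End euclidean.

(* R^h with its Borel sigma-algebra, i.e. the one generated by the open sets. *)
Notation borel_rV R h := (g_sigma_algebraType (@open 'rV[R]_h)).

Section subgaussian.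
Context {R : realType} {h : nat}.
Implicit Types mu : probability (borel_rV R h) R.

Definition msupport mu : set 'rV[R]_h :=
  [set x | forall U : set 'rV[R]_h, open U -> U x -> (0 < mu U)%E].

Definition unbounded_support mu : Prop :=
  forall M : R, exists2 x, msupport mu x & M < enorm x.

Definition has_mean mu : Prop :=
  forall i : 'I_h,
    mu.-integrable [set: borel_rV R h] (fun x => ((x : 'rV[R]_h) ord0 i)%:E).

(* Meaningful only under [has_mean mu]. *)
Definition mean mu : 'rV[R]_h :=
  \row_(i < h) fine ('E_mu[fun x : borel_rV R h => (x : 'rV[R]_h) ord0 i]).

Definition P_uB (Gamma : R) mu : Prop :=
  [/\ unbounded_support mu,
      has_mean mu,
      enorm (mean mu) <= Gamma
    & exists2 tau : R, 0 < tau <= Gamma &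
        forall a : 'rV[R]_h,
          ('E_mu[fun x : borel_rV R h => expR (dotv a ((x : 'rV[R]_h) - mean mu))]
             <= (expR (enorm a ^+ 2 * tau ^+ 2 / 2))%:E)%E].

End subgaussian.

Section independence.
Context {d d' : measure_display} {Omega : measurableType d}
  {T : measurableType d'} {R : realType} (P : probability Omega R).

Definition mutually_independent (n : nat) (X : 'I_n -> {RV P >-> T}) : Prop :=
  forall (J : {set 'I_n}) (A : 'I_n -> set T),
    (forall i, measurable (A i)) ->
    P [set w | forall i, i \in J -> A i (X i w)] =
      (\prod_(i in J) P (X i @^-1` A i))%E.

Definition iid_from (n : nat) (mu : probability T R)
    (X : 'I_n -> {RV P >-> T}) : Prop :=
  (forall i (A : set T), measurable A -> distribution P (X i) A = mu A)
  /\ mutually_independent X.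

(* Independence of the sigma-algebras generated by the two families. *)
Definition independent_collections (n m : nat)
    (X : 'I_n -> {RV P >-> T}) (Y : 'I_m -> {RV P >-> T}) : Prop :=
  forall A B : set Omega,
    g_sigma_preimage (fun i => X i : Omega -> T) A ->
    g_sigma_preimage (fun j => Y j : Omega -> T) B ->
    P (A `&` B) = (P A * P B)%E.

End independence.

(* Main.v *)
(** Averaging out the variables one at a time keeps [F] Lipschitz in the
    remaining ones, and independence lets each step be carried out on the
    exponential moment itself; it therefore suffices to bound
    [E exp (l (g x - E g x))] for a [c]-Lipschitz [g] of a single sub-Gaussian
    vector [x].  By Jensen and symmetrization with an independent copy [x'] this
    is at most [E cosh (l (g x - g x')) <= E exp ((l c)^2 |x - x'|^2 / 2)].
    Linearising the square with an independent Gaussian reduces the last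
    expectation to the Laplace transform of [x - x'], which yields
    [(1 - 2 (l c tau)^2)^(-h/2) <= exp (2 h Gamma^2 (l c)^2)] for small [l].
    Chernoff's inequality concludes; the constraint on [eps] is what keeps the
    optimal [l] in the admissible range. *)

Require Import Defs.
From HB Require Import structures.
From mathcomp Require Import all_boot all_order all_algebra.
From mathcomp Require Import all_classical all_reals all_analysis.
From mathcomp Require Import measurable_realfun.
From mathcomp Require Import ring lra.
Import Order.TTheory GRing.Theory Num.Theory.
Import numFieldNormedType.Exports.

Set Implicit Arguments.
Unset Strict Implicit.
Unset Printing Implicit Defensive.

Local Open Scope classical_set_scope.
Local Open Scope ring_scope.

(** * Gaussian integrals and exponential moments of squares *)

Section gaussian_integrals.
Context {R : realType}.
Local Notation leb := (@lebesgue_measure R).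

(** Completing the square: tilting the centred density by [expR (g * z)] gives a constant times the
    density with mean [s ^+ 2 * z]. *)
Lemma integral_normal_pdf_expR (s z : R) : s != 0 ->
  (\int[leb]_g (normal_pdf 0 s g * expR (g * z))%:E
    = (expR (s ^+ 2 / 2 * z ^+ 2))%:E)%E.
Proof.
move=> s0.
have E g : normal_pdf 0 s g * expR (g * z)
    = expR (s ^+ 2 / 2 * z ^+ 2) * normal_pdf (s ^+ 2 * z) s g.
  rewrite !normal_pdfE// /normal_fun mulrCA -!mulrA -!expRD.
  by congr (_ * expR _); field.
under eq_integral do rewrite E EFinM.
rewrite ge0_integralZl//=.
- by rewrite integral_normal_pdf mule1.
- by apply/measurable_EFinP; exact: measurable_normal_pdf.
- by move=> x _; rewrite lee_fin normal_pdf_ge0.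
Qed.

(** With [k] the square root of [1 - 2 * t * s ^+ 2], the integrand is [k^-1] times the centred
    density of standard deviation [s / k]. *)
Lemma integral_normal_pdf_expR_sqr (s t : R) : 0 < s -> 2 * t * s ^+ 2 < 1 ->
  (\int[leb]_g (normal_pdf 0 s g * expR (t * g ^+ 2))%:E
    = ((Num.sqrt (1 - 2 * t * s ^+ 2))^-1)%:E)%E.
Proof.
move=> s0 ts1; set k := Num.sqrt _.
have k0 : 0 < k by rewrite sqrtr_gt0 subr_gt0.
have k2 : k ^+ 2 = 1 - 2 * t * s ^+ 2 by rewrite sqr_sqrtr// subr_ge0 ltW.
have sk0 : s / k != 0 by rewrite mulf_neq0 ?invr_neq0 ?gt_eqF.
have E g : normal_pdf 0 s g * expR (t * g ^+ 2) = k^-1 * normal_pdf 0 (s / k) g.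
  rewrite !normal_pdfE// ?gt_eqF//.
  have -> : normal_peak (s / k) = k * normal_peak s.
      rewrite /normal_peak.
    have -> : (s / k) ^+ 2 * pi *+ 2 = k^-1 ^+ 2 * (s ^+ 2 * pi *+ 2) :> R.
      by rewrite exprMn; move: (pi : R) => p; rewrite (mulrC (s ^+ 2)) -mulrA mulrnAr.
    rewrite sqrtrM ?sqr_ge0// sqrtr_sqr ger0_norm ?invr_ge0 ?ltW//.
    by rewrite invfM invrK.
  rewrite mulrA mulKf ?gt_eqF// -!mulrA /normal_fun -expRD; congr (_ * expR _).
  rewrite exprMn exprVn k2; field.
  by rewrite gt_eqF ?subr_gt0//= gt_eqF.
under eq_integral do rewrite E EFinM.
rewrite ge0_integralZl//=.
- by rewrite integral_normal_pdf mule1.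
- by apply/measurable_EFinP; exact: measurable_normal_pdf.
- by move=> x _; rewrite lee_fin normal_pdf_ge0.
- by rewrite lee_fin invr_ge0 ltW.
Qed.

(* Gaussian linearisation: writing each exp (s^2 z_i^2 / 2) as the average of
   exp (g z_i) over a centred Gaussian g of variance s^2 reduces the
   exponential moment of |z|^2 to the Laplace transform of z. *)
Lemma expR_sqr_moment d (T : measurableType d) (rho : probability T R) (h : nat)
    (z : 'I_h -> T -> R) (s t : R) :
  (forall i, measurable_fun setT (z i)) -> 0 < s -> 2 * t * s ^+ 2 < 1 ->
  (forall a : 'I_h -> R, (\int[rho]_w (expR (\sum_i a i * z i w))%:E
     <= (expR (t * \sum_i a i ^+ 2))%:E)%E) ->
  (\int[rho]_w (expR (s ^+ 2 / 2 * \sum_i z i w ^+ 2))%:E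
     <= ((Num.sqrt (1 - 2 * t * s ^+ 2))^-1 ^+ h)%:E)%E.
Proof.
move=> mz s0 ts1 hz; set K := (Num.sqrt _)^-1.
have K0 : 0 <= K by rewrite invr_ge0 sqrtr_ge0.
(* Interpolation from the hypothesis ([k = 0]) to the goal ([k = h]): the first [k] coordinates are
   squared, the others still linear. [q k] keeps the coefficients that remain, and each step costs a
   factor [K]. *)
pose e k (a : 'I_h -> R) (i : 'I_h) w :=
  if (i < k)%N then s ^+ 2 / 2 * z i w ^+ 2 else a i * z i w.
pose q k (a : 'I_h -> R) (i : 'I_h) := if (i < k)%N then 0 else a i ^+ 2.
have me k a i : measurable_fun setT (e k a i).
  rewrite /e; case: (i < k)%N; apply: measurable_funM => //.
  by apply: measurable_funX; exact: mz.
suff main k : (k <= h)%N -> forall a, (\int[rho]_w (expR (\sum_i e k a i w))%:E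
    <= (K ^+ k * expR (t * \sum_i q k a i))%:E)%E.
  have := main h (leqnn h) (fun=> 0); rewrite /q big1; last first.
    by move=> i _; rewrite ltn_ord.
  rewrite mulr0 expR0 mulr1; apply: le_trans; rewrite le_eqVlt; apply/orP; left.
  apply/eqP/eq_integral => w _; rewrite mulr_sumr; congr (expR _)%:E.
  by apply: eq_bigr => i _; rewrite /e ltn_ord.
elim: k => [|k IH] kh a; first by rewrite expr0 mul1r; exact: hz.
pose i0 := Ordinal kh.
(* The coefficient of [z i0] becomes a Gaussian variable [g]; averaging over [g] produces the square
   of [z i0]. *)
pose b g i := if i == i0 then g else a i.
have eS w : \sum_i e k.+1 a i w
    = s ^+ 2 / 2 * z i0 w ^+ 2 + \sum_(i | i != i0) e k.+1 a i w.
  by rewrite (bigD1 i0)//= {1}/e ltnSn.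
have ltS (i : 'I_h) : i != i0 -> (i < k.+1)%N = (i < k)%N.
  by move=> ii0; rewrite ltnS leq_eqVlt (negbTE (_ : i != k :> nat)).
have eb g w : \sum_i e k (b g) i w
    = g * z i0 w + \sum_(i | i != i0) e k.+1 a i w.
  rewrite (bigD1 i0)//= {1}/e ltnn {1}/b eqxx; congr (_ + _).
  by apply: eq_bigr => i ii0; rewrite /e ltS// /b (negbTE ii0).
have qb g : \sum_i q k (b g) i = g ^+ 2 + \sum_i q k.+1 a i.
  rewrite (bigD1 i0)//= [in RHS](bigD1 i0)//= {1 3}/q ltnn ltnSn /b eqxx add0r.
  by congr (_ + _); apply: eq_bigr => i ii0; rewrite /q ltS// (negbTE ii0).
pose f (wg : T * R) :=
  (normal_pdf 0 s wg.2 * expR (\sum_i e k (b wg.2) i wg.1))%:E.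
have mf : measurable_fun setT f.
  apply/measurable_EFinP; apply: measurable_funM.
    by apply: measurableT_comp => //; exact: measurable_normal_pdf.
  apply: measurableT_comp => //.
  under eq_fun do rewrite eb -big_filter.
  apply: measurable_funD.
    by apply: measurable_funM => //; apply: measurableT_comp.
  by apply: measurable_sum => i; apply: measurableT_comp.
have f0 x : (0 <= f x)%E by rewrite lee_fin mulr_ge0 ?normal_pdf_ge0 ?expR_ge0.
have -> : (\int[rho]_w (expR (\sum_i e k.+1 a i w))%:E
    = \int[rho]_w \int[leb]_g f (w, g))%E.
  apply: eq_integral => w _; rewrite /f/=.
  under [RHS]eq_integral do rewrite eb expRD mulrA EFinM.
  rewrite ge0_integralZr//=.
  - by rewrite integral_normal_pdf_expR ?gt_eqF// -EFinM -expRD eS.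
  - apply/measurable_EFinP; apply: measurable_funM.
      exact: measurable_normal_pdf.
    by apply: measurableT_comp => //; exact: measurable_funM.
  - by move=> x _; rewrite lee_fin mulr_ge0 ?normal_pdf_ge0 ?expR_ge0.
(* With the Gaussian average outside, the induction hypothesis applies to [b g] for each fixed [g];
   the factor [expR (t * g ^+ 2)] that it leaves averages to [K]. *)
rewrite fubini_tonelli//=.
apply: (@le_trans _ _ (\int[leb]_g
    ((K ^+ k * expR (t * \sum_i q k.+1 a i))%:E *
     (normal_pdf 0 s g * expR (t * g ^+ 2))%:E))%E).
  apply: ge0_le_integral => //.
  - by move=> x _; exact: integral_ge0.
  - exact: measurable_fun_fubini_tonelli_G.
  - apply/measurable_EFinP; apply: measurable_funM => //.
    apply: measurable_funM; first exact: measurable_normal_pdf.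
    apply: measurableT_comp => //; apply: measurable_funM => //.
  - move=> g _; rewrite /f/=.
    under eq_integral do rewrite EFinM.
    rewrite ge0_integralZl//=.
    + apply: le_trans (lee_wpmul2l _ (IH (ltnW kh) (b g))) _.
        by rewrite lee_fin normal_pdf_ge0.
      rewrite -!EFinM lee_fin qb mulrDr expRD le_eqVlt; apply/orP; left.
      by apply/eqP; ring.
    + apply/measurable_EFinP; apply: measurableT_comp => //.
      by apply: measurable_sum => i.
    + by rewrite lee_fin normal_pdf_ge0.
rewrite ge0_integralZl//=.
- rewrite integral_normal_pdf_expR_sqr// -EFinM lee_fin -/K exprSr.
  by rewrite mulrAC.
- apply/measurable_EFinP; apply: measurable_funM.
    exact: measurable_normal_pdf.
  apply: measurableT_comp => //; apply: measurable_funM => //.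
- by move=> x _; rewrite lee_fin mulr_ge0 ?normal_pdf_ge0 ?expR_ge0.
- by rewrite lee_fin mulr_ge0 ?expR_ge0 ?exprn_ge0.
Qed.

End gaussian_integrals.

(** * Functions Lipschitz in each argument: telescoping and measurability *)

Section lipschitz.
Context {R : realType} {h : nat}.
Implicit Types (v : 'rV[R]_h).

Lemma dotvv_ge0 v : 0 <= dotv v v.
Proof. by apply: sumr_ge0 => i _; rewrite -expr2 sqr_ge0. Qed.

Lemma enorm_ge0 v : 0 <= enorm v.
Proof. exact: sqrtr_ge0. Qed.

Lemma sqr_enorm v : enorm v ^+ 2 = \sum_i v ord0 i ^+ 2.
Proof. by rewrite sqr_sqrtr ?dotvv_ge0//; apply: eq_bigr => i _; rewrite expr2. Qed.

Lemma enorm_le_sum v : enorm v <= \sum_i `|v ord0 i|.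
Proof.
have S0 : 0 <= \sum_i `|v ord0 i| by apply: sumr_ge0.
rewrite -(@ler_pXn2r _ 2) ?nnegrE ?enorm_ge0// sqr_enorm expr2 mulr_suml.
apply: ler_sum => i _; rewrite -real_normK ?num_real// expr2 ler_wpM2l//.
by rewrite (bigD1 i)//= lerDl sumr_ge0.
Qed.

(** One constant per index: the two samples carry different ones, and a variable that has been
    averaged out gets the constant 0. *)
Definition coord_lipschitz N (c : 'I_N -> R) (F : ('I_N -> 'rV[R]_h) -> R) :=
  forall i u u', (forall k, k != i -> u k = u' k) ->
    `|F u - F u'| <= c i * enorm (u i - u' i).

(** Telescoping along the hybrids [w k], which pass from [u] to [u'] by changing one argument at a
    time. *)
Lemma coord_lipschitz_sum N (c : 'I_N -> R) (F : ('I_N -> 'rV[R]_h) -> R) :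
  coord_lipschitz c F ->
  forall u u', `|F u - F u'| <= \sum_i c i * enorm (u i - u' i).
Proof.
move=> lipF u u'.
pose w k (i : 'I_N) := if (i < k)%N then u' i else u i.
suff main k : (k <= N)%N ->
    `|F u - F (w k)| <= \sum_(i < N | (i < k)%N) c i * enorm (u i - u' i).
  have wN : w N = u' by apply/funext => i; rewrite /w ltn_ord.
  have := main N (leqnn N); rewrite wN => /le_trans; apply.
  by rewrite le_eqVlt; apply/orP; left; apply/eqP/eq_bigl => i; rewrite ltn_ord.
elim: k => [_|k IH kN].
  rewrite big_pred0//; have -> : w 0%N = u by apply/funext.
  by rewrite subrr normr0.
pose i0 := Ordinal kN.
have -> : \sum_(i < N | (i < k.+1)%N) c i * enorm (u i - u' i)
    = c i0 * enorm (u i0 - u' i0)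
      + \sum_(i < N | (i < k)%N) c i * enorm (u i - u' i).
  rewrite (bigD1 i0)//=; congr (_ + _); apply: eq_bigl => i.
  by rewrite ltnS ltn_neqAle andbC.
rewrite [leRHS]addrC; apply: le_trans (ler_distD (F (w k)) _ _) _.
apply: lerD (IH (ltnW kN)) _.
have wu : w k i0 = u i0 by rewrite /w ltnn.
have wu' : w k.+1 i0 = u' i0 by rewrite /w ltnSn.
rewrite -wu -wu'; apply: lipF => j ji0.
by rewrite /w ltnS [in RHS]leq_eqVlt (negbTE (_ : j != k :> nat)).
Qed.

Lemma measurable_coord (i : 'I_h) :
  measurable_fun [set: borel_rV R h] (fun x => (x : 'rV[R]_h) ord0 i).
Proof.
apply: (measurability _ (RGenOInfty.measurableE R)) => _ [_ [a ->] <-].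
rewrite setTI; apply: sub_sigma_algebra => /=.
apply: open_comp; last exact: rray_open.
by move=> x _; exact: coord_continuous.
Qed.

(* A Lipschitz function exceeds [a] at [u] iff one of the countably many cones
   [F q - C |u - q|], [q] rational, does. *)
Lemma measurable_coord_lipschitz N (c : 'I_N -> R) F d (T : measurableType d)
    (Z : 'I_N -> T -> borel_rV R h) :
  coord_lipschitz c F -> (forall i, measurable_fun setT (Z i)) ->
  measurable_fun setT (fun w => F (Z ^~ w)).
Proof.
move=> lipF mZ.
pose C := 1 + \sum_i `|c i|.
have C0 : 0 < C by rewrite ltr_pwDl// sumr_ge0.
(* The cones use the l1 distance, which dominates the Euclidean one and is built from coordinates,
   whose measurability is known. *)
pose dist u (q : 'I_N -> 'rV[R]_h) : R :=
  C * \sum_i \sum_j `|(u i : 'rV[R]_h) ord0 j - q i ord0 j|.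
have lipD u q : `|F u - F q| <= dist u q.
  apply: le_trans (coord_lipschitz_sum lipF u q) _.
  rewrite /dist mulr_sumr; apply: ler_sum => i _.
  apply: (@le_trans _ _ (C * enorm (u i - q i))).
    apply: ler_wpM2r; first exact: enorm_ge0.
    apply: le_trans (ler_norm _) _.
    by rewrite /C (bigD1 i)//= addrCA lerDl addr_ge0// sumr_ge0.
  apply: ler_wpM2l; first exact: ltW.
  apply: le_trans (enorm_le_sum _) _.
  by apply: ler_sum => j _; rewrite !mxE.
pose qq (q : 'M[rat]_(N, h)) i : 'rV[R]_h := \row_j ratr (q i j).
apply: (measurability _ (RGenOInfty.measurableE R)) => _ [_ [a ->] <-].
rewrite setTI.
rewrite (_ : _ @^-1` _ = \bigcup_(q : 'M[rat]_(N, h))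
   (fun w => F (qq q) - dist (Z ^~ w) (qq q)) @^-1` `]a, +oo[%classic).
  apply: countable_bigcupT_measurable => // q; rewrite -[X in measurable X]setTI.
  apply: (_ : measurable_fun setT _) => //.
  apply: measurable_funB => //; apply: measurable_funM => //.
  apply: measurable_sum => i; apply: measurable_sum => j.
  apply: measurableT_comp => //; apply: measurable_funB => //.
  by apply: (measurableT_comp (measurable_coord j)).
apply/seteqP; split => [w /=|w [q _]] /=; rewrite !in_itv/= !andbT; last first.
  move=> /lt_le_trans; apply; rewrite lerBlDl -lerBlDr.
  by rewrite -[leLHS]opprB lerNl; have := lipD (Z ^~ w) (qq q); rewrite ler_norml => /andP[].
move=> aF.
(* Precision [e] in every coordinate gives a distance of at most [C * (N * h)%:R * e]; the successor
   makes this strictly less than [M * e], half the gap [F - a]. Half is needed because the distance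
   is lost twice, in [F (qq q)] and in the cone. *)
pose M : R := C * (N * h).+1%:R.
have M0 : 0 < M by rewrite mulr_gt0.
pose e := (F (Z ^~ w) - a) / (2 * M).
have e0 : 0 < e by rewrite divr_gt0 ?subr_gt0 ?mulr_gt0.
have ex i j : exists r : rat, `|(Z i w : 'rV[R]_h) ord0 j - ratr r| <= e.
  have [//|r] := @rat_in_itvoo R ((Z i w : 'rV[R]_h) ord0 j) ((Z i w : 'rV[R]_h) ord0 j + e).
    by rewrite ltrDl.
  rewrite in_itv/= => /andP[r1 r2]; exists r; rewrite distrC ger0_norm; lra.
pose q : 'M[rat]_(N, h) := \matrix_(i, j) sval (cid (ex i j)).
exists q => //=; rewrite in_itv/= andbT.
have De : dist (Z ^~ w) (qq q) < M * e.
  rewrite /dist /M -mulrA ltr_pM2l//.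
  apply: (@le_lt_trans _ _ ((N * h)%:R * e)).
    apply: (@le_trans _ _ (\sum_(i < N) \sum_(j < h) e)).
      apply: ler_sum => i _; apply: ler_sum => j _.
      by rewrite /qq /q !mxE; exact: svalP (cid (ex i j)).
    by rewrite !sumr_const !card_ord -mulrnA mulr_natl mulnC.
  by rewrite ltr_pM2r// ltr_nat.
have Me : M * e = (F (Z ^~ w) - a) / 2.
  by rewrite /e; field; rewrite gt_eqF.
have := lipD (Z ^~ w) (qq q); rewrite ler_norml => /andP[_].
lra.
Qed.

End lipschitz.

(** * Elementary inequalities for the exponential *)

Section cosh_bound.
Context {R : realType}.
Implicit Types x y : R.

Lemma ge0_derive_ge (f df : R -> R) x : 0 <= x ->
  (forall y, is_derive y 1 f (df y)) -> (forall y, 0 <= y -> 0 <= df y) ->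
  f 0 <= f x.
Proof.
rewrite le_eqVlt => /predU1P[<-//|x0] fdf df0.
have cf : {within `[0, x], continuous f}.
  apply: continuous_in_subspaceT => y _.
  by apply/differentiable_continuous/derivable1_diffP; have [] := fdf y.
have [c] := MVT x0 (fun y _ => fdf y) cf.
rewrite in_itv/= => /andP[c0 _]; rewrite subr0 => E.
by rewrite -subr_ge0 E mulr_ge0 ?(ltW x0)// df0// ltW.
Qed.

(** This is [cosh x <= exp (x^2 / 2)]. The quotient of the two sides decreases for [x >= 0]: the
    derivative of its negative [f] has the sign of [a], and [a] is nonnegative since it vanishes at
    0 and has derivative [z * (expR z - expR (- z))]. *)
Lemma expR_symm_le x : expR x + expR (- x) <= 2 * expR (x ^+ 2 / 2).
Proof.
wlog x0 : x / 0 <= x.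
  move=> H; have [/H//|/ltW xN] := leP 0 x.
  by have := H (- x); rewrite oppr_ge0 sqrrN opprK (addrC (expR (- x))); exact.
pose a y : R := (1 + y) * expR (- y) - (1 - y) * expR y.
have a0 y : 0 <= y -> 0 <= a y.
  move=> y0; have <- : a 0 = 0 by rewrite /a; rewrite oppr0 expR0; ring.
  apply: (@ge0_derive_ge a (fun z => z * (expR z - expR (- z)))) => // [z|z z0].
    rewrite /a; apply: is_derive_eq.
    by rewrite /GRing.scale/=; ring.
  by rewrite mulr_ge0// subr_ge0 ler_expR; lra.
pose f y : R := - ((expR y + expR (- y)) * expR (- (y ^+ 2 / 2))).
have : f 0 <= f x.
  apply: (@ge0_derive_ge f (fun z => a z * expR (- (z ^+ 2 / 2)))) => // [z|z z0].
    rewrite /f; apply: is_derive_eq.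
    by rewrite /GRing.scale/= /a; field.
  by rewrite mulr_ge0 ?a0 ?expR_ge0.
rewrite /f expr0n/= mul0r !oppr0 expR0 mulr1 lerN2 [expR (- (_ / _))]expRN.
by rewrite ler_pdivrMr ?expR_gt0.
Qed.

(** After squaring, [expR (2 * x) >= 1 + 2 * x] reduces the claim to [(1 - x) * (1 + 2 * x) >= 1],
    which holds exactly for [x] between 0 and 1/2. *)
Lemma sqrt_oneB_le_expR x : 0 <= x <= 1 / 2 -> (Num.sqrt (1 - x))^-1 <= expR x.
Proof.
move=> /andP[x0 x1]; have p : 0 < 1 - x by lra.
rewrite invf_ple ?posrE ?expR_gt0 ?sqrtr_gt0//.
rewrite -(@ler_pXn2r _ 2) ?nnegrE ?sqrtr_ge0 ?invr_ge0 ?expR_ge0//.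
rewrite sqr_sqrtr ?(ltW p)// exprVn -expRM_natl.
rewrite -div1r ler_pdivrMr ?expR_gt0//.
apply: (@le_trans _ _ ((1 - x) * (1 + 2 * x))); first by nra.
by rewrite ler_pM2l// expR_ge1Dx.
Qed.

End cosh_bound.

(** * Exponential moment of a Lipschitz function of one sub-Gaussian vector *)

Section subgaussian_lipschitz.
Context {R : realType} {h : nat}.
Local Notation T := (borel_rV R h).

(** Growth is at most linear: [F] is dominated by its value at the origin plus a weighted l1 norm of
    the arguments, whose coordinates are integrable. *)
Lemma integrable_coord_lipschitz N (c : 'I_N -> R) F d (S : measurableType d)
    (P : probability S R) (Z : 'I_N -> S -> T) :
  coord_lipschitz c F -> (forall i, measurable_fun setT (Z i)) ->
  (forall i j, P.-integrable setT (fun w => ((Z i w : 'rV[R]_h) ord0 j)%:E)) ->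
  P.-integrable setT (fun w => (F (Z ^~ w))%:E).
Proof.
move=> lipF mZ iZ.
pose B w := `|F (fun=> 0)| + \sum_i `|c i| * \sum_j `|(Z i w : 'rV[R]_h) ord0 j|.
have B0 w : 0 <= B w.
  by rewrite addr_ge0// sumr_ge0// => i _; rewrite mulr_ge0// sumr_ge0.
apply: (@le_integrable _ _ _ P setT measurableT _ (fun w => (B w)%:E)).
- by apply/measurable_EFinP; exact: measurable_coord_lipschitz lipF mZ.
- move=> w _; rewrite !abse_EFin lee_fin (ger0_norm (B0 w)).
  rewrite -(subrK (F (fun=> 0)) (F _)) addrC.
  apply: le_trans (ler_normD _ _) _; rewrite lerD2l.
  apply: le_trans (coord_lipschitz_sum lipF _ _) _.
  apply: ler_sum => i _; apply: (@le_trans _ _ (`|c i| * enorm (Z i w - 0))).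
    by rewrite ler_wpM2r ?enorm_ge0// ler_norm.
  rewrite ler_wpM2l// subr0; exact: enorm_le_sum.
- rewrite /B; under eq_fun do rewrite EFinD -sumEFin.
  apply: integrableD => //.
    by apply: finite_measure_integrable_cst.
  apply: integrable_sum => // i _.
  under eq_fun do rewrite EFinM -sumEFin.
  apply: integrableZl => //; apply: integrable_sum => // j _.
  exact: integrable_abse (iZ i j).
Qed.

Definition elipschitz (c : R) (g : 'rV[R]_h -> R) :=
  forall v v', `|g v - g v'| <= c * enorm (v - v').

(** Lets the results on several arguments serve for a single vector. *)
Lemma elipschitz_coord c g : elipschitz c g ->
  coord_lipschitz (fun=> c) (fun u : 'I_1 -> 'rV[R]_h => g (u ord0)).
Proof. by move=> lipg i u u' _; rewrite (ord1 i); exact: lipg. Qed.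

Lemma measurable_elipschitz c g : elipschitz c g ->
  measurable_fun [set: T] (g : T -> R).
Proof.
move=> /elipschitz_coord lipg.
exact: (measurable_coord_lipschitz (Z := fun=> id) lipg).
Qed.

Lemma integrable_elipschitz c g (mu : probability T R) : elipschitz c g ->
  has_mean mu -> mu.-integrable [set: T] (fun v => (g v)%:E).
Proof.
move=> /elipschitz_coord lipg mmu.
by apply: (integrable_coord_lipschitz (Z := fun=> id) lipg) => // _ j; exact: mmu.
Qed.

(** Gaussian linearisation applied to the difference of two independent copies. The condition on [s]
    keeps [2 * tau ^+ 2 * s ^+ 2] below 1/2, the range in which the inverse square root is bounded
    by an exponential. *)
Lemma symmetrized_sqr_moment (Gamma s : R) (mu : probability T R) :
  P_uB Gamma mu -> 0 < s -> s ^+ 2 * Gamma ^+ 2 <= 1 / 4 ->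
  (\int[mu \x mu]_p (expR (s ^+ 2 / 2 *
      \sum_i ((p.1 : 'rV[R]_h) ord0 i - (p.2 : 'rV[R]_h) ord0 i) ^+ 2))%:E
    <= (expR (2 * h%:R * Gamma ^+ 2 * s ^+ 2))%:E)%E.
Proof.
move=> [_ _ _ [tau /andP[tau0 tauG] sg]] s0 sG.
have tG2 : tau ^+ 2 <= Gamma ^+ 2.
  by rewrite ler_pXn2r// nnegrE ltW// (lt_le_trans tau0).
have s20 : 0 < s ^+ 2 by rewrite exprn_gt0.
have t20 : 0 < tau ^+ 2 by rewrite exprn_gt0.
have st : s ^+ 2 * tau ^+ 2 <= 1 / 4.
  by apply: le_trans sG; rewrite ler_wpM2l// ltW.
pose m := mean mu.
pose z (i : 'I_h) (p : T * T) : R := (p.1 : 'rV[R]_h) ord0 i - (p.2 : 'rV[R]_h) ord0 i.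
have mz i : measurable_fun setT (z i).
  by apply: measurable_funB; apply: (measurableT_comp (measurable_coord i)).
pose E (a : 'rV[R]_h) (v : T) := expR (dotv a ((v : 'rV[R]_h) - m)).
have mE a : measurable_fun setT (E a).
  apply: measurableT_comp => //; rewrite /dotv.
  apply: measurable_sum => i; apply: measurable_funM => //.
  under eq_fun do rewrite !mxE.
  by apply: measurable_funB => //; exact: measurable_coord.
have iE a : (\int[mu]_v (E a v)%:E <= (expR (tau ^+ 2 / 2 * \sum_i a ord0 i ^+ 2))%:E)%E.
  have := sg a; rewrite unlock => /le_trans; apply.
  by rewrite lee_fin ler_expR sqr_enorm; lra.
have := @expR_sqr_moment R _ _ (mu \x mu)%E h z s (tau ^+ 2) mz s0 _ _.
rewrite -/z => H; apply: le_trans (H _ _) _ => {H}.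
- by lra.
- move=> a; pose av : 'rV[R]_h := \row_i a i.
  (* The mean cancels in the difference, so both factors are centred. Each contributes
     [tau ^+ 2 / 2] to the exponent, whence the choice [t = tau ^+ 2]. *)
  have zE p : expR (\sum_i a i * z i p) = E av p.1 * E (- av) p.2.
    rewrite -expRD /dotv -big_split/=; congr expR; apply: eq_bigr => i _.
    by rewrite /z !mxE; ring.
  under eq_integral do rewrite zE EFinM.
  rewrite fubini_tonelli1//=; last 2 first.
  + apply: emeasurable_funM; apply/measurable_EFinP.
      by apply: (measurableT_comp (mE av)).
    by apply: (measurableT_comp (mE (- av))).
  + by move=> p; rewrite mule_ge0// lee_fin expR_ge0.
  rewrite /fubini_F/=.
  under eq_integral.
    move=> v _; rewrite ge0_integralZl//=; last 3 first.
    - by apply/measurable_EFinP; exact: mE.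
    - by move=> w _; rewrite lee_fin expR_ge0.
    - by rewrite lee_fin expR_ge0.
    over.
  rewrite ge0_integralZr//=; last 3 first.
  + by apply/measurable_EFinP; exact: mE.
  + by move=> w _; rewrite lee_fin expR_ge0.
  + by apply: integral_ge0 => w _; rewrite lee_fin expR_ge0.
  apply: le_trans (lee_pmul _ _ (iE av) (iE (- av))) _.
  + by apply: integral_ge0 => w _; rewrite lee_fin expR_ge0.
  + by apply: integral_ge0 => w _; rewrite lee_fin expR_ge0.
  rewrite -EFinM lee_fin -expRD ler_expR.
  have sE (b : 'rV[R]_h) : (forall i, b ord0 i ^+ 2 = a i ^+ 2) ->
      \sum_(i < h) b ord0 i ^+ 2 = \sum_i a i ^+ 2.
    by move=> bE; apply: eq_bigr => i _.
  rewrite (sE av) ?(sE (- av)) => [|i|i]; last 2 first.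
  + by rewrite !mxE sqrrN.
  + by rewrite !mxE.
  lra.
- rewrite lee_fin; apply: (@le_trans _ _ (expR (2 * tau ^+ 2 * s ^+ 2) ^+ h)).
    rewrite lerXn2r ?nnegrE ?invr_ge0 ?sqrtr_ge0 ?expR_ge0//.
    by apply: sqrt_oneB_le_expR; rewrite !mulr_ge0 ?(ltW s20) ?(ltW t20)//=; lra.
  rewrite -expRM_natl ler_expR.
  have -> : 2 * h%:R * Gamma ^+ 2 * s ^+ 2
      = h%:R * (2 * Gamma ^+ 2 * s ^+ 2) by ring.
  by rewrite ler_wpM2l// ler_wpM2r ?(ltW s20)// ler_pM2l.
Qed.

(** With [I k] the integral of [expR (k * g v)], symmetrization bounds [I l * I (- l)] by [B], and
    Jensen bounds [I (- l)] below by [expR (- l * gm)]; dividing gives the claim. *)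
Lemma subgaussian_lipschitz_mgf (Gamma c l : R) (mu : probability T R) g :
  P_uB Gamma mu -> elipschitz c g -> 0 < c -> 0 < l ->
  (l * c) ^+ 2 * Gamma ^+ 2 <= 1 / 4 ->
  (\int[mu]_v (expR (l * g v))%:E
    <= (expR (2 * h%:R * Gamma ^+ 2 * (l * c) ^+ 2
              + l * fine (\int[mu]_v (g v)%:E)))%:E)%E.
Proof.
move=> muP lipg c0 l0 lc.
have mg := measurable_elipschitz lipg.
have [_ mmu _ _] := muP.
have ig := integrable_elipschitz lipg mmu.
set gm := fine _; pose B := expR (2 * h%:R * Gamma ^+ 2 * (l * c) ^+ 2).
have gmE : (\int[mu]_v (g v)%:E)%E = gm%:E.
  by rewrite /gm fineK//; exact: integrable_fin_num.
pose E (k : R) (v : T) := expR (k * g v).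
have mE k : measurable_fun [set: T] (E k).
  by apply: measurableT_comp => //; apply: measurable_funM.
pose I k := (\int[mu]_v (E k v)%:E)%E.
have I0 k : (0 <= I k)%E by apply: integral_ge0 => v _; rewrite lee_fin expR_ge0.
have prodI k k' : (\int[mu \x mu]_p (E k p.1 * E k' p.2)%:E = I k * I k')%E.
  under eq_integral do rewrite EFinM.
  rewrite fubini_tonelli1//=; last 2 first.
  + apply: emeasurable_funM; apply/measurable_EFinP.
      by apply: (measurableT_comp (mE k)).
    by apply: (measurableT_comp (mE k')).
  + by move=> p; rewrite mule_ge0// lee_fin expR_ge0.
  rewrite /fubini_F/=.
  under eq_integral.
    move=> v _; rewrite ge0_integralZl//=; last 3 first.
    - by apply/measurable_EFinP; exact: mE.
    - by move=> w _; rewrite lee_fin expR_ge0.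
    - by rewrite lee_fin expR_ge0.
    over.
  rewrite ge0_integralZr//=.
  + by apply/measurable_EFinP; exact: mE.
  + by move=> w _; rewrite lee_fin expR_ge0.
  + exact: I0.
have lm0 : 0 < l * c by rewrite mulr_gt0.
(* Swapping the two independent copies and averaging bounds the product by the
   integral of [cosh (l (g v - g v'))]. *)
have IIB : (I l * I (- l)%R <= B%:E)%E.
  rewrite -(@lee_pmul2l _ 2%:E)//.
  rewrite mule_natl mule2n {2}muleC -!prodI -ge0_integralD//=; last 4 first.
  - by move=> p _; rewrite lee_fin mulr_ge0 ?expR_ge0.
  - apply/measurable_EFinP; apply: measurable_funM.
      by apply: (measurableT_comp (mE l)).
    by apply: (measurableT_comp (mE (- l))).
  - by move=> p _; rewrite lee_fin mulr_ge0 ?expR_ge0.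
  - apply/measurable_EFinP; apply: measurable_funM.
      by apply: (measurableT_comp (mE (- l))).
    by apply: (measurableT_comp (mE l)).
  apply: le_trans (lee_wpmul2l _ (symmetrized_sqr_moment muP lm0 lc)); last first.
    by rewrite lee_fin.
  pose D (p : T * T) := \sum_i ((p.1 : 'rV[R]_h) ord0 i - (p.2 : 'rV[R]_h) ord0 i) ^+ 2.
  have mD : measurable_fun setT D.
    apply: measurable_sum => i; apply: measurable_funX.
    by apply: measurable_funB; apply: (measurableT_comp (measurable_coord i)).
  have meD : measurable_fun setT (fun p => (expR ((l * c) ^+ 2 / 2 * D p))%:E).
    apply/measurable_EFinP; apply: measurableT_comp => //.
    exact: measurable_funM.
  rewrite -ge0_integralZl//=.
  apply: ge0_le_integral => //=.
  - by move=> p _; rewrite lee_fin addr_ge0// mulr_ge0 ?expR_ge0.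
  - apply/measurable_EFinP; apply: measurable_funD.
      apply: measurable_funM.
        by apply: (measurableT_comp (mE l)).
      by apply: (measurableT_comp (mE (- l))).
    apply: measurable_funM.
      by apply: (measurableT_comp (mE (- l))).
    by apply: (measurableT_comp (mE l)).
  - exact: emeasurable_funM.
  - move=> p _; rewrite -EFinM -EFinD lee_fin /E -!expRD.
    have -> : l * g p.1 + - l * g p.2 = l * (g p.1 - g p.2) by ring.
    have -> : - l * g p.1 + l * g p.2 = - (l * (g p.1 - g p.2)) by ring.
    (* After the cosh bound, the Lipschitz condition replaces the squared increment of [g] by
       [c ^+ 2 * D p], which matches the squared moment at [s = l * c]. *)
    apply: le_trans (expR_symm_le _) _; rewrite ler_pM2l// ler_expR.
    rewrite [leRHS]mulrAC ler_wpM2r// ?invr_ge0// 2!exprMn -mulrA ler_wpM2l ?sqr_ge0//.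
    rewrite -/(D p); have -> : D p = enorm ((p.1 : 'rV[R]_h) - p.2) ^+ 2.
      by rewrite sqr_enorm; apply: eq_bigr => i _; rewrite !mxE.
    rewrite -exprMn -real_normK ?num_real//.
    by rewrite ler_pXn2r ?nnegrE ?mulr_ge0 ?enorm_ge0 ?(ltW c0)//; exact: lipg.
(* Jensen through the tangent of the exponential at the mean: the affine minorant
   [K * (1 + l * gm) - K * l * g v] integrates to [K]. When [I (- l)] is infinite there is nothing
   to prove; otherwise its integrand is integrable. *)
have Ige : ((expR (- l * gm))%:E <= I (- l)%R)%E.
  have [->|Ioo] := eqVneq (I (- l)) +oo%E; first by rewrite leey.
  pose K := expR (- l * gm).
  have iA : mu.-integrable [set: T] (fun=> (K * (1 + l * gm))%:E).
    exact: finite_measure_integrable_cst.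
  have iK : mu.-integrable [set: T] (fun v => (K * l)%:E * (g v)%:E)%E.
    exact: integrableZl.
  have <- : (\int[mu]_v ((K * (1 + l * gm))%:E - (K * l)%:E * (g v)%:E) = K%:E)%E.
    rewrite integralB// integralZl// integral_cst//.
    rewrite [X in (_ * X - _)%E](probability_setT mu) mule1 gmE.
    by rewrite -EFinM -EFinB; congr _%:E; ring.
  apply: le_integral => //; first exact: integrableB.
    apply/integrableP; split; first by apply/measurable_EFinP; exact: mE.
    under eq_integral do rewrite gee0_abs ?lee_fin ?expR_ge0//.
    by rewrite ltey.
  move=> v _; rewrite -EFinM -EFinB lee_fin /E.
  have -> : - l * g v = - l * gm + - l * (g v - gm) by ring.
  rewrite expRD; apply: le_trans (ler_wpM2l (expR_ge0 _) (expR_ge1Dx _)).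
  by rewrite -/K le_eqVlt; apply/orP; left; apply/eqP; ring.
have : (I l * (expR (- l * gm))%:E <= B%:E)%E.
  exact: le_trans (lee_wpmul2l (I0 l) Ige) IIB.
rewrite muleC -lee_pdivlMl ?expR_gt0// => /le_trans; apply.
by rewrite -EFinM lee_fin mulNr expRN invrK mulrC -expRD.
Qed.

End subgaussian_lipschitz.

(** * Replacing one variable of an independent family by a fresh copy *)

Definition upd N (A : Type) (u : 'I_N -> A) (k : 'I_N) (a : A) : 'I_N -> A :=
  fun i => if i == k then a else u i.

Lemma upd_eq N A (u : 'I_N -> A) k a : upd u k a k = a.
Proof. by rewrite /upd eqxx. Qed.

Lemma upd_neq N A (u : 'I_N -> A) k a i : i != k -> upd u k a i = u i.
Proof. by rewrite /upd => /negbTE->. Qed.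

Section resampling.
Context {d} {T : measurableType d} {R : realType} {N : nat}.

(** Families are turned into tuples because these carry the sigma-algebra generated by the
    coordinates. *)
Definition box (A : 'I_N -> set T) : set (N.-tuple T) :=
  [set t | forall i, A i (tnth t i)].

Lemma boxE (A : 'I_N -> set T) :
  box A = \big[setI/setT]_i ((@tnth _ T ^~ i) @^-1` A i).
Proof.
rewrite -bigcap_seq; apply/seteqP; split => t /= tA i; first by move=> _; exact: tA.
by apply: tA; rewrite /= mem_index_enum.
Qed.

Lemma measurable_box (A : 'I_N -> set T) :
  (forall i, measurable (A i)) -> measurable (box A).
Proof.
move=> mA; rewrite boxE; apply: bigsetI_measurable => i _.
by rewrite -[X in measurable X]setTI; exact: measurable_tnth.
Qed.

(** Boxes are stable under intersection and generate: the preimage of a set under one coordinate is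
    the box with [setT] at all other indices. *)
Lemma probability_box_unique (m1 m2 : probability (N.-tuple T) R) :
  (forall A, (forall i, measurable (A i)) -> m1 (box A) = m2 (box A)) ->
  forall B, measurable B -> m1 B = m2 B.
Proof.
move=> m12 B mB.
pose G := [set B | exists2 A, (forall i, measurable (A i)) & B = box A].
have GT : G setT by exists (fun=> setT) => //; apply/seteqP; split.
apply: (measure_unique G (fun=> setT)) => //.
- apply/seteqP; split; last first.
    apply: smallest_sub; first exact: sigma_algebra_measurable.
    by move=> _ [A mA ->]; exact: measurable_box.
  apply: smallest_sub; first exact: smallest_sigma_algebra.
  move=> C; rewrite -bigcup_seq => -[i _ [A mA <-]].
  apply: sub_sigma_algebra; exists (fun j => if j == i then A else setT).
    by move=> j; case: eqP.
  apply/seteqP; split=> [t /= [_ At] j|t /= /(_ i)]; last by rewrite eqxx.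
  by case: eqP => // ->.
- move=> _ _ [A mA ->] [A' mA' ->]; exists (fun i => A i `&` A' i).
    by move=> i; exact: measurableI.
  apply/seteqP; split=> [t [tA tA'] i|t H]; first by split; [exact: tA|exact: tA'].
  by split=> i; case: (H i).
- exact: bigcup_const.
- by move=> _ [A mA ->]; exact: m12.
- by move=> _; rewrite (le_lt_trans (probability_le1 _ _))// ltry.
Qed.

Context {d'} {S : measurableType d'} (P : probability S R)
  (Z : 'I_N -> S -> T) (law : 'I_N -> probability T R).
Hypothesis mZ : forall i, measurable_fun setT (Z i).
Hypothesis lawZ : forall A, (forall i, measurable (A i)) ->
  P [set w | forall i, A i (Z i w)] = (\prod_i law i (A i))%E.

Let joint w : N.-tuple T := [tuple Z i w | i < N].
Let resampled k (p : S * T) : N.-tuple T := [tuple upd (Z ^~ p.1) k p.2 i | i < N].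

Let measurable_joint : measurable_fun setT joint.
Proof.
apply/measurable_fun_tnthP => i.
by apply: (eq_measurable_fun (Z i)) => // w _; rewrite /= tnth_mktuple.
Qed.

Lemma measurable_upd k i : measurable_fun setT
  (fun p : S * T => upd (Z ^~ p.1) k p.2 i).
Proof.
by rewrite /upd; case: (i == k) => //; exact: measurableT_comp.
Qed.

Let measurable_resampled k : measurable_fun setT (resampled k).
Proof.
apply/measurable_fun_tnthP => i.
apply: (eq_measurable_fun (fun p => upd (Z ^~ p.1) k p.2 i)) => [p _|].
  by rewrite /= tnth_mktuple.
exact: measurable_upd.
Qed.

Let X1 : {mfun S >-> N.-tuple T} :=
  HB.pack joint (isMeasurableFun.Build _ _ _ _ _ measurable_joint).
Let X2 k : {mfun (S * T)%type >-> N.-tuple T} :=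
  HB.pack (resampled k) (isMeasurableFun.Build _ _ _ _ _ (@measurable_resampled k)).

(** Drawing the [k]-th variable anew from its own law leaves the joint law unchanged: both sides
    give a box the product of its marginal masses, and boxes determine the law. *)
Lemma pushforward_resample k B : measurable B ->
  pushforward P joint B = pushforward (P \x law k)%E (resampled k) B.
Proof.
move=> mB.
apply: (@probability_box_unique (distribution P X1)
  (distribution (P \x law k)%E (X2 k))) => // A mA.
rewrite /distribution/= /pushforward/=.
transitivity (\prod_i law i (A i))%E.
  rewrite -lawZ//; congr (P _); apply/seteqP.
  by split=> w /= wA i; have := wA i; rewrite tnth_mktuple.
(* The old [k]-th variable is discarded, so it is left unconstrained; the factor [law k (A k)] comes
   from the fresh copy. *)
pose A' (i : 'I_N) := if i == k then setT else A i.
have mA' i : measurable (A' i) by rewrite /A'; case: eqP.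
have -> : resampled k @^-1` box A = [set w | forall i : 'I_N, A' i (Z i w)] `*` A k.
  apply/seteqP; split=> -[w v] /=.
    move=> H; split=> [i|]; last by have := H k; rewrite tnth_mktuple /upd eqxx.
    by have := H i; rewrite tnth_mktuple /upd /A'; case: eqP.
  move=> [wA vA] i; rewrite tnth_mktuple /upd.
  by have := wA i; rewrite /A'; case: eqP => // ->.
rewrite product_measure1E//; last first.
  rewrite (_ : [set w | _] = joint @^-1` box A').
    by rewrite -[X in measurable X]setTI; apply: measurable_joint => //; exact: measurable_box.
  by apply/seteqP; split=> w /= wA i; have := wA i; rewrite tnth_mktuple.
rewrite [X in (_ = X * _)%E](lawZ mA') (bigD1 k)//= [in RHS](bigD1 k)//=.
rewrite {1}/A' eqxx probability_setT mul1e.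
rewrite muleC; congr (_ * _)%E; apply: eq_bigr => i ik.
by rewrite /A' (negbTE ik).
Qed.

(** Equality of laws followed by Tonelli: the [k]-th variable can be integrated first, with the
    others frozen. *)
Lemma ge0_integral_resample k (f : N.-tuple T -> \bar R) :
  measurable_fun setT f -> (forall t, 0 <= f t)%E ->
  (\int[P]_w f (joint w) = \int[P]_w \int[law k]_v f (resampled k (w, v)))%E.
Proof.
move=> mf f0.
transitivity (\int[pushforward P joint]_t f t)%E.
  by rewrite ge0_integral_pushforward.
transitivity (\int[pushforward (P \x law k)%E (resampled k)]_t f t)%E.
  apply: (@eq_measure_integral _ _ _ _ (distribution (P \x law k)%E (X2 k))
    (distribution P X1)) => B mB _.
  exact: pushforward_resample.
rewrite ge0_integral_pushforward// fubini_tonelli1//.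
  exact: measurableT_comp.
by move=> p; exact: f0.
Qed.

(** The signed version, with Fubini in place of Tonelli. *)
Lemma integral_resample k (f : N.-tuple T -> \bar R) :
  measurable_fun setT f ->
  (P \x law k)%E.-integrable setT (f \o resampled k) ->
  P.-integrable setT (f \o joint) ->
  (\int[P]_w f (joint w) = \int[P]_w \int[law k]_v f (resampled k (w, v)))%E.
Proof.
move=> mf if2 if1.
transitivity (\int[pushforward P joint]_t f t)%E.
  by rewrite integral_pushforward.
transitivity (\int[pushforward (P \x law k)%E (resampled k)]_t f t)%E.
  apply: (@eq_measure_integral _ _ _ _ (distribution (P \x law k)%E (X2 k))
    (distribution P X1)) => B mB _.
  exact: pushforward_resample.
by rewrite integral_pushforward// -integral12_prod_meas1.
Qed.

End resampling.

(** * Averaging out the variables one at a time *)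

Section tensorization.
Context {R : realType} {h N : nat}.
Local Notation T := (borel_rV R h).
Implicit Types F : ('I_N -> 'rV[R]_h) -> R.

Lemma elipschitz_upd (c : 'I_N -> R) F u k : coord_lipschitz c F ->
  elipschitz (c k) (fun v => F (upd u k v)).
Proof.
move=> lipF v v'; have := lipF k (upd u k v) (upd u k v').
rewrite !upd_eq; apply=> i ik.
by rewrite !upd_neq.
Qed.

(** For an independent family this is the conditional expectation given the other variables. It
    keeps all [N] arguments, so that the induction stays within one type of functions. *)
Definition avg (law : 'I_N -> probability T R) k F u : R :=
  \int[law k]_v F (upd u k v).

(** The result ignores argument [k], hence the constant 0 there. For the others, the bound on the
    increment does not depend on the integrated variable, and a probability measure preserves it. *)
Lemma coord_lipschitz_avg (law : 'I_N -> probability T R) (c : 'I_N -> R) F k :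
  coord_lipschitz c F -> has_mean (law k) ->
  coord_lipschitz (upd c k 0) (avg law k F).
Proof.
move=> lipF mk i u u' uu'.
have iF u0 : (law k).-integrable setT (EFin \o (fun v : T => F (upd u0 k v))).
  exact: integrable_elipschitz (elipschitz_upd u0 k lipF) mk.
move: uu'; have [->|ik] := eqVneq i k => uu'.
  rewrite /upd eqxx mul0r /avg.
  rewrite (_ : (fun v => F (upd u k v)) = fun v => F (upd u' k v)) ?subrr ?normr0//.
  apply/funext => v; congr F; apply/funext => j; rewrite /upd.
  by case: eqVneq => // jk; exact: uu'.
have iB := integrableB measurableT (iF u) (iF u').
rewrite /avg -RintegralB//; apply: le_trans (le_normr_Rintegral _ _) _ => //.
apply: (@le_trans _ _ (\int[law k]_v (c i * enorm (u i - u' i)))).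
  apply: le_Rintegral => //.
  - exact: integrable_abse iB.
  - exact: finite_measure_integrable_cst.
  - move=> v _; have := lipF i (upd u k v) (upd u' k v).
    rewrite !(upd_neq _ _ ik); apply => j ji; rewrite /upd.
    by case: ifP => // _; exact: uu'.
by rewrite Rintegral_cst// [X in fine X](probability_setT (law k)) mulr1 upd_neq.
Qed.

Context {d} {S : measurableType d} (P : probability S R)
  (Z : 'I_N -> S -> T) (law : 'I_N -> probability T R).
Hypothesis mZ : forall i, measurable_fun setT (Z i).
Hypothesis lawZ : forall A, (forall i, measurable (A i)) ->
  P [set w | forall i, A i (Z i w)] = (\prod_i law i (A i))%E.
Hypothesis mean_law : forall i, has_mean (law i).

(** Resampling the variable [i] itself turns the integral of the absolute value into one against
    [law i], finite by [mean_law]. *)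
Lemma integrable_marginal i j :
  P.-integrable setT (fun w => ((Z i w : 'rV[R]_h) ord0 j)%:E).
Proof.
pose f (t : N.-tuple T) : \bar R := (`|(tnth t i : 'rV[R]_h) ord0 j|)%:E.
have mf : measurable_fun setT f.
  apply/measurable_EFinP; apply: measurableT_comp => //.
  apply: (measurableT_comp (measurable_coord j)); exact: measurable_tnth.
apply/integrableP; split.
  by apply/measurable_EFinP; exact: (measurableT_comp (measurable_coord j)).
have := ge0_integral_resample mZ lawZ i mf (fun=> normr_ge0 _).
rewrite /f; under eq_integral do rewrite tnth_mktuple.
move=> ->.
under eq_integral.
  move=> w _; under eq_integral do rewrite tnth_mktuple /upd eqxx/=.
  over.
rewrite integral_cst// [X in (_ * X)%E](probability_setT P) mule1.
by have /integrableP[] := mean_law i j.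
Qed.

Lemma integrable_upd i j k :
  (P \x law k)%E.-integrable setT
    (fun p => ((upd (Z ^~ p.1) k p.2 i : 'rV[R]_h) ord0 j)%:E).
Proof.
apply/integrable12ltyP.
  apply/measurable_EFinP; apply: (measurableT_comp (measurable_coord j)).
  exact: measurable_upd.
rewrite /upd/=; case: (i == k).
  rewrite integral_cst// [X in (_ * X)%E](probability_setT P) mule1.
  by have /integrableP[] := mean_law k j.
under eq_integral do
  rewrite integral_cst// [X in (_ * X)%E](probability_setT (law k)) mule1.
by have /integrableP[] := integrable_marginal i j.
Qed.

(** The tower property, from the signed resampling identity; its integrability conditions follow
    from the linear growth of [F]. *)
Lemma integral_avg (c : 'I_N -> R) F k : coord_lipschitz c F ->
  \int[P]_w avg law k F (Z ^~ w) = \int[P]_w F (Z ^~ w).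
Proof.
move=> lipF.
pose f (t : N.-tuple T) := (F (tnth t))%:E.
have mf : measurable_fun setT f.
  apply/measurable_EFinP.
  exact: (measurable_coord_lipschitz lipF (fun i => measurable_tnth i)).
have tE (u : 'I_N -> T) : f [tuple u i | i < N] = (F u)%:E.
  by rewrite /f; congr (F _)%:E; apply/funext => i; rewrite tnth_mktuple.
have := @integral_resample _ _ _ _ _ _ P Z law mZ lawZ k f mf.
have -> : f \o (fun p => [tuple upd (Z^~ p.1) k p.2 i | i < N])
    = fun p => (F (upd (Z ^~ p.1) k p.2))%:E.
  by apply/funext => p /=; rewrite tE.
have -> : f \o (fun w => [tuple Z i w | i < N]) = fun w => (F (Z ^~ w))%:E.
  by apply/funext => w /=; rewrite tE.
move=> H; rewrite /Rintegral; congr fine.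
transitivity (\int[P]_w f [tuple Z i w | i < N])%E; last first.
  by apply: eq_integral => w _; exact: tE.
rewrite H; last 2 first.
- apply: (@integrable_coord_lipschitz R h N c F _ _ (P \x law k)%E
    (fun i p => upd (Z ^~ p.1) k p.2 i) lipF) => [i|i j].
    exact: measurable_upd.
  exact: integrable_upd.
- exact: (integrable_coord_lipschitz lipF mZ integrable_marginal).
apply: eq_integral => w _; rewrite /avg /Rintegral fineK.
  by apply: eq_integral => v _; rewrite tE.
apply: integrable_fin_num => //.
exact: integrable_elipschitz (elipschitz_upd (Z ^~ w) k lipF) (mean_law k).
Qed.

(** Induction on a list [s] containing the variables on which [F] may still depend. The constants
    [c] drop to 0 on the way, whereas the one-vector bound asks for a positive constant: hence the
    fixed upper bounds [b]. *)
Lemma subgaussian_tensorization (Gamma l : R) (b : 'I_N -> R) :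
  (forall i, P_uB Gamma (law i)) -> 0 < l -> (forall i, 0 < b i) ->
  (forall i, (l * b i) ^+ 2 * Gamma ^+ 2 <= 1 / 4) ->
  forall (s : seq 'I_N) (c : 'I_N -> R) F,
  coord_lipschitz c F -> (forall i, c i <= b i) ->
  (forall i, i \notin s -> c i = 0) ->
  (\int[P]_w (expR (l * F (Z ^~ w)))%:E
    <= (expR (\sum_(i <- s) 2 * h%:R * Gamma ^+ 2 * (l * b i) ^+ 2
              + l * \int[P]_w F (Z ^~ w)))%:E)%E.
Proof.
move=> lawP l0 b0 lb; elim=> [|k s IH] c F lipF cb cs.
  (* All the constants are 0 here, so [F] is constant and equality holds. *)
  have Fcst u : F u = F (fun=> 0).
    apply/eqP; rewrite -subr_eq0 -normr_le0.
    apply: le_trans (coord_lipschitz_sum lipF _ _) _.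
    by rewrite big1// => i _; rewrite cs// mul0r.
  under eq_integral do rewrite Fcst.
  under [in leRHS]eq_Rintegral do rewrite Fcst.
  rewrite Rintegral_cst// integral_cst// [X in (_ * X <= _)%E](probability_setT P).
  by rewrite [X in fine X](probability_setT P) mulr1 mule1 big_nil add0r.
pose f (t : N.-tuple T) := (expR (l * F (tnth t)))%:E.
have mf : measurable_fun setT f.
  apply/measurable_EFinP; apply: measurableT_comp => //.
  apply: measurable_funM => //.
  exact: (measurable_coord_lipschitz lipF (fun i => measurable_tnth i)).
have f0 t : (0 <= f t)%E by rewrite lee_fin expR_ge0.
have tE (u : 'I_N -> T) : f [tuple u i | i < N] = (expR (l * F u))%:E.
  by rewrite /f; congr (expR (l * F _))%:E; apply/funext => i; rewrite tnth_mktuple.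
have := ge0_integral_resample mZ lawZ k mf f0.
under eq_integral do rewrite tE.
under [in X in _ = X -> _]eq_integral.
  by move=> w _; under eq_integral do rewrite tE; over.
move=> -> /=.
have lipA := coord_lipschitz_avg lipF (mean_law k).
have mA : measurable_fun setT (fun w => expR (l * avg law k F (Z ^~ w))).
  apply: measurableT_comp => //; apply: measurable_funM => //.
  exact: measurable_coord_lipschitz lipA mZ.
set D := fun i => 2 * h%:R * Gamma ^+ 2 * (l * b i) ^+ 2.
apply: (@le_trans _ _ (\int[P]_w ((expR (D k))%:E * (expR (l * avg law k F (Z ^~ w)))%:E))%E).
  apply: ge0_le_integral => //=.
  - by move=> w _; apply: integral_ge0 => v _; rewrite lee_fin expR_ge0.
  - pose g (p : S * T) := (expR (l * F (upd (Z ^~ p.1) k p.2)))%:E.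
    apply: (@measurable_fun_fubini_tonelli_F _ _ _ _ _ (law k) g).
      apply/measurable_EFinP; apply: measurableT_comp => //.
      apply: measurable_funM => //.
      exact: (measurable_coord_lipschitz lipF (@measurable_upd _ _ _ _ _ _ mZ k)).
    by move=> p; rewrite lee_fin expR_ge0.
  - by apply: emeasurable_funM => //; exact/measurable_EFinP.
  (* For frozen [w] the inner integral is the exponential moment of a [b k]-Lipschitz function of
     one vector, with mean [avg law k F (Z ^~ w)]. *)
  - move=> w _; rewrite -EFinM -expRD.
    apply: subgaussian_lipschitz_mgf => // v v'.
    apply: le_trans (elipschitz_upd (Z ^~ w) k lipF v v') _.
    by rewrite ler_wpM2r ?enorm_ge0.
rewrite ge0_integralZl//=; last exact/measurable_EFinP.
(* The induction hypothesis is applied to the averaged function, which has the same expectation as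
   [F]. *)
apply: le_trans (lee_wpmul2l _ (IH _ _ lipA _ _)) _.
- by rewrite lee_fin expR_ge0.
- by move=> i; rewrite /upd; case: ifP => // _; exact: ltW.
- move=> i is_; rewrite /upd; case: eqVneq => // ik.
  by rewrite cs// inE negb_or ik.
rewrite (integral_avg k lipF) -EFinM -expRD lee_fin big_cons -/(D k).
by rewrite addrA.
Qed.

End tensorization.

(** * Exponential Markov inequality *)

Lemma integral_expR_markov d (S : measurableType d) (R : realType)
    (P : probability S R) (G : S -> R) (l a : R) :
  measurable_fun setT G -> 0 < l ->
  (P [set w | (a <= G w)%R] <= (expR (- (l * a)))%:E * \int[P]_w (expR (l * G w))%:E)%E.
Proof.
move=> mG l0; set A := [set w | _].
have mA : measurable A.
  rewrite (_ : A = G @^-1` `[a, +oo[%classic).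
    by rewrite -[X in measurable X]setTI; exact: mG.
  by apply/seteqP; split => w /=; rewrite in_itv/= andbT.
have mE : measurable_fun setT (fun w => (expR (l * G w))%:E).
  by apply/measurable_EFinP; apply: measurableT_comp => //; exact: measurable_funM.
rewrite -[X in (P X)]setIT -integral_indic// -ge0_integralZl//=.
apply: ge0_le_integral => //=.
- exact/measurable_EFinP/measurable_indic.
- exact: emeasurable_funM.
- move=> w _; rewrite -EFinM lee_fin -expRD indicE.
  have [|_] := boolP (w \in A); last by rewrite expR_ge0.
  (* On the event the exponent [l * (G w - a)] is nonnegative, so its exponential dominates the
     indicator. *)
  rewrite inE /A/= => aG; apply: le_trans (expR_ge1Dx _).
  by rewrite lerDl addrC -mulrBr mulr_ge0 ?subr_ge0// ltW.
Qed.

(** * Joining the two samples into one independent family *)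

Section two_samples.
Context {d d'} {Omega : measurableType d} {T : measurableType d'} {R : realType}
  (P : probability Omega R).

(** The sigma-algebra generated by the family is pulled back from tuples along the joint map, and
    the event is the preimage of a box. This makes independence of the two collections applicable to
    boxes. *)
Lemma g_sigma_preimage_box n (X : 'I_n -> {RV P >-> T}) (A : 'I_n -> set T) :
  (forall i, measurable (A i)) ->
  g_sigma_preimage (fun i => X i : Omega -> T) [set w | forall i, A i (X i w)].
Proof.
move=> mA; pose joint w : n.-tuple T := [tuple X i w | i < n].
have -> : (fun i => X i : Omega -> T) = (fun i => (@tnth n T ^~ i) \o joint).
  by apply/funext => i; apply/funext => w /=; rewrite tnth_mktuple.
rewrite g_sigma_preimage_comp; exists (box A).
  exact: measurable_box.
apply/seteqP; split=> w /=.
  by move=> [_ H] i; have := H i; rewrite tnth_mktuple.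
by move=> H; split=> // i; rewrite tnth_mktuple.
Qed.

Lemma iid_box n (mu : probability T R) (X : 'I_n -> {RV P >-> T}) (A : 'I_n -> set T) :
  iid_from mu X -> (forall i, measurable (A i)) ->
  P [set w | forall i, A i (X i w)] = (\prod_i mu (A i))%E.
Proof.
move=> [lawX indX] mA.
transitivity (P [set w | forall i, i \in [set: 'I_n]%SET -> A i (X i w)]).
  congr (P _); apply/seteqP; split=> w /= H i; first by move=> _; exact: H.
  by apply: H; rewrite inE.
rewrite indX//; under eq_bigl do rewrite inE.
by apply: eq_bigr => i _; exact: lawX.
Qed.

(** Serves for the samples, their laws and the Lipschitz constants alike. *)
Definition concat (A : Type) n m (u : 'I_n -> A) (v : 'I_m -> A) (k : 'I_(n + m)) : A :=
  match fintype.split k with inl i => u i | inr j => v j end.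

Lemma concatl (A : Type) n m (u : 'I_n -> A) (v : 'I_m -> A) i :
  concat u v (lshift m i) = u i.
Proof. by rewrite /concat (unsplitK (inl i)). Qed.

Lemma concatr (A : Type) n m (u : 'I_n -> A) (v : 'I_m -> A) j :
  concat u v (rshift n j) = v j.
Proof. by rewrite /concat (unsplitK (inr j)). Qed.

(** A box event splits into an event on [x] and one on [y]; independence between the collections,
    then within each, factors its probability. *)
Lemma iid_concat_box n m (mu nu : probability T R)
    (x : 'I_n -> {RV P >-> T}) (y : 'I_m -> {RV P >-> T})
    (A : 'I_(n + m) -> set T) :
  iid_from mu x -> iid_from nu y -> independent_collections x y ->
  (forall i, measurable (A i)) ->
  P [set w | forall k, A k (concat (fun i => x i w) (fun j => y j w) k)] =
    (\prod_k concat (fun=> mu) (fun=> nu) k (A k))%E.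
Proof.
move=> xmu ynu xy mA.
have -> : [set w | forall k, A k (concat (fun i => x i w) (fun j => y j w) k)]
    = [set w | forall i, A (lshift m i) (x i w)]
      `&` [set w | forall j, A (rshift n j) (y j w)].
  apply/seteqP; split=> w /= => [H|[Hx Hy] k].
    split=> [i|j]; first by have := H (lshift m i); rewrite concatl.
    by have := H (rshift n j); rewrite concatr.
  by case: (split_ordP k) => i ->; rewrite ?concatl ?concatr.
rewrite xy; last 2 first.
- exact: (g_sigma_preimage_box (fun i => mA (lshift m i))).
- exact: (g_sigma_preimage_box (fun j => mA (rshift n j))).
rewrite (iid_box xmu (fun i => mA (lshift m i))).
rewrite (iid_box ynu (fun j => mA (rshift n j))) big_split_ord/=.
by congr (_ * _)%E; apply: eq_bigr => i _; rewrite ?concatl ?concatr.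
Qed.

End two_samples.

Lemma coord_lipschitz_concat (R : realType) (h n m : nat) (cx cy : R)
    (F : ('I_n -> 'rV[R]_h) -> ('I_m -> 'rV[R]_h) -> R) :
  (forall i u u' v, (forall k, k != i -> u k = u' k) ->
     `|F u v - F u' v| <= cx * enorm (u i - u' i)) ->
  (forall i u v v', (forall k, k != i -> v k = v' k) ->
     `|F u v - F u v'| <= cy * enorm (v i - v' i)) ->
  coord_lipschitz (concat (fun _ : 'I_n => cx) (fun _ : 'I_m => cy))
    (fun u => F (fun i => u (lshift m i)) (fun j => u (rshift n j))).
Proof.
move=> lipx lipy k u u' uu'.
case: (split_ordP k) uu' => [i ->|j ->] uu'.
  rewrite concatl (_ : (fun j => u (rshift n j)) = fun j => u' (rshift n j)).
    by apply: lipx => k' k'i; apply: uu'; rewrite eq_lshift.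
  by apply/funext => j; apply: uu'; rewrite eq_rlshift.
rewrite concatr (_ : (fun i => u (lshift m i)) = fun i => u' (lshift m i)).
  by apply: lipy => k' k'j; apply: uu'; rewrite eq_rshift.
by apply/funext => i; apply: uu'; rewrite eq_lrshift.
Qed.

(** * The concentration inequality: choice of the exponent *)

Theorem theorem5 (R : realType) (h n m : nat)
    (h_ge1 : (1 <= h)%N) (n_ge1 : (1 <= n)%N) (m_ge1 : (1 <= m)%N)
    (Gamma : R) (Gamma_gt0 : 0 < Gamma)
    (mu nu : probability (borel_rV R h) R)
    (mu_uB : P_uB Gamma mu) (nu_uB : P_uB Gamma nu)
    (d : measure_display) (Omega : measurableType d) (P : probability Omega R)
    (x : 'I_n -> {RV P >-> borel_rV R h})
    (y : 'I_m -> {RV P >-> borel_rV R h})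
    (x_iid : iid_from mu x) (y_iid : iid_from nu y)
    (xy_indep : independent_collections x y)
    (L : R) (L_gt0 : 0 < L)
    (F : ('I_n -> 'rV[R]_h) -> ('I_m -> 'rV[R]_h) -> R)
    (F_lip_x : forall (i : 'I_n) (u u' : 'I_n -> 'rV[R]_h) (v : 'I_m -> 'rV[R]_h),
      (forall k, k != i -> u k = u' k) ->
      `|F u v - F u' v| <= L * enorm (u i - u' i) / n%:R)
    (F_lip_y : forall (i : 'I_m) (u : 'I_n -> 'rV[R]_h) (v v' : 'I_m -> 'rV[R]_h),
      (forall k, k != i -> v k = v' k) ->
      `|F u v - F u v'| <= L * enorm (v i - v' i) / m%:R)
    (eps : R) (eps_ge0 : 0 <= eps)
    (eps_le : eps <= Num.sqrt 3 * h%:R * Gamma * L * (minn m n)%:R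
                       * (n%:R^-1 + m%:R^-1)) :
  let G (w : Omega) : R := F (fun i => x i w) (fun j => y j w) in
  (P [set w | (eps <= G w - fine ('E_P[G]))%R]
    <= (expR (- (eps ^+ 2) * m%:R * n%:R
              / (8 * h%:R * Gamma ^+ 2 * L ^+ 2 * (m + n)%:R)))%:E)%E.
Proof.
cbv zeta; pose G (w : Omega) : R := F (fun i => x i w) (fun j => y j w).
rewrite -/G.
pose Z k w := concat (fun i => x i w) (fun j => y j w) k.
pose law := concat (fun _ : 'I_n => mu) (fun _ : 'I_m => nu).
pose b := concat (fun _ : 'I_n => L / n%:R) (fun _ : 'I_m => L / m%:R).
pose F' (u : 'I_(n + m) -> 'rV[R]_h) :=
  F (fun i => u (lshift m i)) (fun j => u (rshift n j)).
have n0 : 0 < n%:R :> R by rewrite ltr0n.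
have m0 : 0 < m%:R :> R by rewrite ltr0n.
have h0 : 0 < h%:R :> R by rewrite ltr0n.
have b0 k : 0 < b k.
  by rewrite /b /concat; case: fintype.split => _; rewrite divr_gt0.
have lawP k : P_uB Gamma (law k) by rewrite /law /concat; case: fintype.split.
have lipF : coord_lipschitz b F'.
  apply: coord_lipschitz_concat => [i u u' v|j u v v'] H; rewrite mulrAC.
    exact: F_lip_x.
  exact: F_lip_y.
have mZ k : measurable_fun setT (Z k).
  by rewrite /Z /concat; case: fintype.split => i; exact: measurable_funPT.
have FZ w : F' (Z ^~ w) = G w.
  rewrite /F' /G /Z; congr F; apply/funext => i; first by rewrite concatl.
  by rewrite concatr.
have mG : measurable_fun setT G.
  apply: eq_measurable_fun (measurable_coord_lipschitz lipF mZ) => w _.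
  exact: FZ.
have EG : fine ('E_P[G])%E = \int[P]_w F' (Z ^~ w).
  by rewrite unlock; congr fine; apply: eq_integral => w _; rewrite FZ.
set e := \int[P]_w F' (Z ^~ w) in EG.
have -> : [set w | eps <= G w - fine ('E_P[G])%E] = [set w | eps + e <= G w].
  by apply/funext => w /=; rewrite EG lerBrDr.
(* For [eps = 0] the bound is 1; this case is apart because the [l] chosen below would vanish. *)
move: eps_ge0; rewrite le_eqVlt => /predU1P[<-|eps0].
  rewrite expr0n/= oppr0 !mul0r expR0 probability_le1//.
  rewrite (_ : [set w | _] = G @^-1` `[0 + e, +oo[%classic).
    by rewrite -[X in measurable X]setTI; exact: mG.
  by apply/seteqP; split => w /=; rewrite in_itv/= andbT.
set r := n%:R^-1 + m%:R^-1 in eps_le.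
have r0 : 0 < r by rewrite addr_gt0 ?invr_gt0.
(* The squares of the [b k] add up to [L ^+ 2 * r], so the exponent to minimise is
   [2 * K * l ^+ 2 - l * eps]; the minimiser is [eps / (4 * K)], with value
   [- eps ^+ 2 / (8 * K)]. *)
pose K := h%:R * Gamma ^+ 2 * L ^+ 2 * r.
have K0 : 0 < K by rewrite !mulr_gt0 ?exprn_gt0.
pose l := eps / (4 * K).
have l0 : 0 < l by rewrite divr_gt0// mulr_gt0.
(* Admissibility of [l], for [p] equal to [n] or [m]: the upper bound on [eps] gives
   [eps / D <= Num.sqrt 3], so the left side is at most 3/16. *)
have lLp (p : R) : 0 < p -> (minn m n)%:R <= p ->
    (l * (L / p)) ^+ 2 * Gamma ^+ 2 <= 1 / 4.
  move=> p0 mnp; rewrite -exprMn.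
  pose D := h%:R * Gamma * L * r * p.
  have D0 : 0 < D by rewrite !mulr_gt0.
  have -> : l * (L / p) * Gamma = eps / D / 4.
    by rewrite /l /K /D; field; rewrite !gt_eqF.
  have q0 : 0 <= eps / D by rewrite divr_ge0// ltW.
  have q3 : eps / D <= Num.sqrt 3.
    rewrite ler_pdivrMr//; apply: le_trans eps_le _.
    rewrite /D (_ : Num.sqrt 3 * (_ * p) = Num.sqrt 3 * h%:R * Gamma * L * p * r).
      by rewrite ler_pM2r// ler_wpM2l// !mulr_ge0 ?sqrtr_ge0// ltW.
    by ring.
  have : (eps / D) ^+ 2 <= 3.
    by rewrite -[leRHS]sqr_sqrtr// ler_pXn2r ?nnegrE ?sqrtr_ge0.
  by rewrite exprMn exprVn; lra.
have lb k : (l * b k) ^+ 2 * Gamma ^+ 2 <= 1 / 4.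
  by rewrite /b /concat; case: fintype.split => _; apply: lLp => //;
    rewrite ler_nat ?geq_minl ?geq_minr.
apply: le_trans (integral_expR_markov P (eps + e) mG l0) _.
under eq_integral do rewrite -FZ.
have mean_law k : has_mean (law k) by have [] := lawP k.
have lawZ A (mA : forall k, measurable (A k)) :
    P [set w | forall k, A k (Z k w)] = (\prod_k law k (A k))%E.
  exact: iid_concat_box.
have tens := subgaussian_tensorization mZ lawZ mean_law lawP l0 b0 lb
  (s := index_enum 'I_(n + m)) lipF (fun=> lexx _) _.
apply: le_trans (lee_wpmul2l _ (tens _)) _.
- by rewrite lee_fin expR_ge0.
- by move=> k; rewrite mem_index_enum.
(* The mean [e] cancels between the Markov factor and the moment bound; evaluating the sum over both
   blocks gives the exponent exactly. *)
rewrite -/e -EFinM -expRD lee_fin ler_expR big_split_ord/=.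
under eq_bigr do rewrite /b concatl.
under [X in _ + X + _]eq_bigr do rewrite /b concatr.
have sumc p (a : R) : \sum_(i < p) a = p%:R * a.
  by rewrite sumr_const card_ord mulr_natl.
rewrite !sumc natrD le_eqVlt; apply/orP; left; apply/eqP.
rewrite /l /K /r; field.
by rewrite !gt_eqF// addr_gt0.
Qed.
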